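(* Let $\alpha\in[0,1]$. Let $G_1$ be a $t_1$-regular graph of order $n_1$ and size $m_1$, and let $G_2=K_{a,b}$ be the complete bipartite graph of order $n_2=a+b$. (a) When $t_1=1$, the $A_\alpha$-spectrum of $G_1\dot\vee_Q G_2$ comprises: (i) one simple eigenvalue $\alpha(1+n_2)$; (ii) one eigenvalue $\alpha(a+2)$ with multiplicity $b-1$; (iii) one eigenvalue $\alpha(b+2)$ with multiplicity $a-1$; and (iv) four eigenvalues obtained by solving the equation $$\big(\nu^2 -\alpha(3+n_2)\nu + 2\alpha^2 n_2 +4\alpha -2 \big) \big( \nu^2 -\alpha (4 + n_2)\nu + 4\alpha^2 + 2\alpha^2n_2 +2\alpha ab -ab \big)-2(1-\alpha)^2(\nu-2\alpha) \big( (\nu-2\alpha)n_2 -\alpha n_2^2 + 2ab \big)=0.$$ (b) When $t_1\ge2$, the $A_\alpha$-spectrum of $G_1\dot\vee_Q G_2$ comprises: (i) one eigenvalue $2\alpha(1+t_1)-2$ with multiplicity $m_1-n_1$; (ii) one eigenvalue $\alpha(n_1+a)$ with multiplicity $b-1$; (iii) one eigenvalue $\alpha(n_1+b)$ with multiplicity $a-1$; (iv) the eigenvalues obtained by solving, for each $i=2,3,\ldots,n_1$, the equation $$\nu^2 - \big(t_1 -2+ \lambda_i(A_{\alpha}(G_1)) + \alpha(2+t_1 +n_2)\big)\nu- 2\alpha(1-\alpha)n_2 -\big(1-\alpha(1+t_1 +n_2) \big)\big(t_1 +\lambda_i(A_{\alpha}(G_1)) \big)=0;$$ and (v) four eigenvalues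 obtained by solving the equation $$\begin{aligned}&\big( \nu^2 -(\alpha t_1 +\alpha n_2 +2\alpha +2t_1 -2)\nu +(2\alpha^2 n_2 + 2\alpha t_1^2 +2\alpha t_1 n_2 +2\alpha t_1 -2\alpha n_2 -2t_1) \big)\\ &\times\big( \nu^2 -\alpha( 2n_1 + n_2)\nu +( \alpha^2n_1^2 + \alpha^2n_1n_2 +2\alpha ab -ab) \big)\\ &-n_1(1-\alpha)^2(\nu+2-2\alpha -2t_1)\big((\nu-\alpha n_1)n_2 -\alpha n_2^2 +2ab \big)=0.\end{aligned}$$
   Context: All graphs are undirected and simple. For a graph $G$ with adjacency matrix $A(G)$ and diagonal degree matrix $D(G)$, put $A_\alpha(G)=\alpha D(G)+(1-\alpha)A(G)$. The $A_\alpha$-spectrum of $G$ is the multiset of eigenvalues of $A_\alpha(G)$. Eigenvalues of a symmetric $n\times n$ matrix $M$ are ordered $\lambda_1(M)\ge\cdots\ge\lambda_n(M)$. The order of a graph is its number of vertices and its size is its number of edges. $K_{a,b}$ is the complete bipartite graph with parts of sizes $a$ and $b$. The $Q$-graph $\mathcal Q(G)$ is obtained from $G$ by inserting a new vertex into each edge of $G$ (so each edge is subdivided: the new vertex is adjacent to the two ends of the edge, and the original edge is no longer present), and then making two new vertices adjacent whenever they lie on adjacent edges of $G$ (distinct edges sharing an endpoint). The $Q$-vertex join $G_1\dot\vee_Q G_2$ is obtained from the disjoint union of $\mathcal Q(G_1)$ and $G_2$ by joining each original vertex of $G_1$ in $\mathcal Q(G_1)$ to every vertex of $G_2$.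
   Formalization: Part (a) additionally assumes G_1 connected (so G_1 = K_2): for a disconnected 1-regular G_1, e.g. 2K_2, the listed n_2+3 eigenvalues cannot exhaust the 3n_1/2+n_2 eigenvalues of the join. Graphs are nonempty and a, b ≥ 1. *)

(* Defs.v *)
From HB Require Import structures.
From mathcomp Require Import all_boot all_order all_algebra.
From mathcomp Require Import polyrcf.

Set Implicit Arguments.
Unset Strict Implicit.
Unset Printing Implicit Defensive.

Import Order.TTheory GRing.Theory Num.Theory.

Local Open Scope ring_scope.

Record sgraph (V : finType) := SGraph {
  adj :> rel V;
  adj_sym : symmetric adj;
  adj_irr : irreflexive adj }.

Section Graphs.
Variable V : finType.
Implicit Type G : sgraph V.

Definition edges G : {set {set V}} :=
  [set e | [exists x, exists y, G x y && (e == [set x; y])]].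

Definition edge G : finType := {e : {set V} | e \in edges G}.

Definition gorder G : nat := #|V|.

Definition gsize G : nat := #|edges G|.

Definition degree G (x : V) : nat := #|[set y | G x y]|.

Definition regular (t : nat) G : Prop := forall x, degree G x = t.

Definition connected G : Prop := forall x y, connect G x y.

(* Vertices of the Q-graph: [inl x] is the original vertex x, and [inr e] is
   the new vertex inserted into the edge e. *)
Definition qgraph_rel G : rel (V + edge G)%type := fun u v =>
  match u, v with
  | inl _, inl _ => false
  | inl x, inr e => x \in val e
  | inr e, inl x => x \in val e
  | inr e, inr f => (e != f) && (val e :&: val f != set0)
  end.

Lemma qgraph_sym G : symmetric (@qgraph_rel G).
Proof. by case=> [x|e] [y|f] //=; rewrite eq_sym setIC. Qed.

Lemma qgraph_irr G : irreflexive (@qgraph_rel G).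
Proof. by case=> [x|e] //=; rewrite eqxx. Qed.

Definition qgraph G : sgraph (V + edge G)%type :=
  SGraph (@qgraph_sym G) (@qgraph_irr G).

End Graphs.

Section QVertexJoin.
Variables (V1 V2 : finType) (G1 : sgraph V1) (G2 : sgraph V2).

Definition qvjoin_rel : rel ((V1 + edge G1) + V2)%type := fun u v =>
  match u, v with
  | inl x, inl y => qgraph G1 x y
  | inr x, inr y => G2 x y
  | inl (inl _), inr _ | inr _, inl (inl _) => true
  | inl (inr _), inr _ | inr _, inl (inr _) => false
  end.

Lemma qvjoin_sym : symmetric qvjoin_rel.
Proof.
move=> [[x|e]|x] [[y|f]|y] //=; last exact: adj_sym.
by rewrite eq_sym setIC.
Qed.

Lemma qvjoin_irr : irreflexive qvjoin_rel.
Proof. by move=> [[x|e]|x] /=; rewrite ?eqxx ?adj_irr. Qed.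

Definition qvjoin : sgraph ((V1 + edge G1) + V2)%type :=
  SGraph qvjoin_sym qvjoin_irr.

End QVertexJoin.

Section CompleteBipartite.
Variables a b : nat.

Definition Kbip_rel : rel ('I_a + 'I_b)%type := fun u v =>
  match u, v with
  | inl _, inr _ | inr _, inl _ => true
  | _, _ => false
  end.

Lemma Kbip_sym : symmetric Kbip_rel. Proof. by case=> x [y|y]. Qed.

Lemma Kbip_irr : irreflexive Kbip_rel. Proof. by case. Qed.

Definition Kbip : sgraph ('I_a + 'I_b)%type := SGraph Kbip_sym Kbip_irr.

End CompleteBipartite.

Section Spectrum.
Variable R : rcfType.

Section Matrices.
Variables (V : finType) (G : sgraph V).

(* Rows and columns are indexed by V through its enumeration. *)
Definition adj_mx : 'M[R]_#|V| :=
  \matrix_(i, j) (G (enum_val i) (enum_val j))%:R.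

Definition deg_mx : 'M[R]_#|V| :=
  diag_mx (\row_i (degree G (enum_val i))%:R).

Definition Aalpha (alpha : R) : 'M[R]_#|V| :=
  alpha *: deg_mx + (1 - alpha) *: adj_mx.

End Matrices.

(* The multiset, as a list up to permutation, of the roots of p in R, each
   repeated according to its multiplicity. *)
Definition mroots (p : {poly R}) : seq R :=
  flatten [seq nseq (mup x p) x | x <- rootsR p].

Definition spectrum n (M : 'M[R]_n) : seq R := mroots (char_poly M).

(* The i-th largest eigenvalue counted with multiplicity; i starts at 1. *)
Definition eigval n (M : 'M[R]_n) (i : nat) : R :=
  (sort >=%R (spectrum M))`_i.-1.

End Spectrum.

(* Main.v *)
Require Import Defs.
From HB Require Import structures.
From mathcomp Require Import all_boot all_order all_algebra.
From mathcomp Require Import polyrcf complex sesquilinear spectral.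
From mathcomp Require Import ring lra zify.

Import Order.TTheory GRing.Theory Num.Theory.
Local Open Scope ring_scope.

(* Order the vertices of the join as edges of G1, vertices of G1, vertices of
   K_{a,b}, and let B be the incidence matrix of G1, so that the line graph has
   adjacency matrix B^T B - 2 and B B^T = A(G1) + t1.  In the characteristic
   matrix of the join, block column operations eliminate the edge block
   q - (1 - alpha) B^T B, where q = X - (2 alpha (1 + t1) - 2), at the cost of
   q^n1 against q^m1; the vertex block becomes an affine function of A_alpha(G1)
   whose determinant is the product of the quadratics over its spectrum.  What
   remains is a rank three perturbation of a block diagonal matrix, so a 3 x 3
   determinant gives the quartic, which absorbs the quadratic of the largest
   eigenvalue t1:
     q^n1 * chi = q^m1 * (quadratics, i >= 2) * (linear factors) * quartic.
   The characteristic polynomial chi splits over R, hence so do its monic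
   factors.  For t1 = 1, G1 is K_2 and one factor q of its quadratic cancels. *)

(** * Split polynomials over a real closed field and their root multisets *)

Section Splitting.
Variable R : rcfType.
Implicit Types (p q : {poly R}) (s : seq R).

(** There is no leading coefficient, so a polynomial that [splits] is monic and is recovered exactly
    from its roots. *)
Definition splits p := exists s, p = \prod_(x <- s) ('X - x%:P).

(** [rootsR p] is duplicate-free, so only the block of [x] itself can contribute copies of [x]. *)
Lemma count_mroots p x : p != 0 -> count_mem x (mroots p) = mup x p.
Proof.
move=> p0; rewrite /mroots count_flatten -map_comp sumnE big_map.
under eq_bigr => y _ do rewrite /= count_nseq /=.
have urs : uniq (rootsR p) by rewrite /rootsR uniq_roots.
have rP : (x \in rootsR p) = root p x.
  by rewrite -(roots_on_rootsR p0) in_itv.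
have [xr|xNr] := boolP (x \in rootsR p).
  rewrite (bigD1_seq x) //= eqxx mul1n big1 ?addn0 // => y /negPf ->.
  by rewrite mul0n.
rewrite (@mupNroot _ x p) -?rP // big_seq big1 // => y yr.
by case: eqP => [yx|]; rewrite ?mul0n //; move: xNr; rewrite -yx yr.
Qed.

Lemma mroots_prod_XsubC s : perm_eq (mroots (\prod_(x <- s) ('X - x%:P))) s.
Proof.
apply/allP => x _; apply/eqP.
by rewrite count_mroots ?mu_prod_XsubC // monic_neq0 // monic_prod_XsubC.
Qed.

Lemma prod_mroots p : splits p -> \prod_(x <- mroots p) ('X - x%:P) = p.
Proof. by case=> s ->; apply/perm_big/mroots_prod_XsubC. Qed.

Lemma size_mroots p : splits p -> size (mroots p) = (size p).-1.
Proof. by move=> /prod_mroots {2}<-; rewrite size_prod_XsubC. Qed.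

Lemma perm_mroots p s :
  p = \prod_(x <- s) ('X - x%:P) -> perm_eq (mroots p) s.
Proof. by move=> ->; apply: mroots_prod_XsubC. Qed.

(** Up to a unit, a divisor of a product of linear factors is a subproduct, and monicity removes the
    unit. This is how the quadratics and the quartic inherit real roots from the characteristic
    polynomial. *)
Lemma splits_dvdp p q : p \is monic -> splits q -> p %| q -> splits p.
Proof.
move=> pm [s ->] /dvdp_prod_XsubC[m]; rewrite eqp_monic ?monic_prod_XsubC //.
by move/eqP=> ->; exists (mask m s).
Qed.

Lemma char_poly_conjmx {F : fieldType} {n} (P A : 'M[F]_n) :
  P \in unitmx -> char_poly (invmx P *m A *m P) = char_poly A.
Proof.
move=> uP; rewrite /char_poly.
suff ->: char_poly_mx (invmx P *m A *m P) =
    map_mx polyC (invmx P) *m char_poly_mx A *m map_mx polyC P.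
  rewrite !det_mulmx mulrAC -det_mulmx -map_mxM mulVmx //.
  by rewrite map_mx1 det1 mul1r.
rewrite /char_poly_mx mulmxBr mulmxBl !map_mxM mul_mx_scalar -scalemxAl.
by rewrite -(map_mxM _ (invmx P) P) mulVmx // map_mx1 scalemx1.
Qed.

(* A real symmetric matrix is Hermitian over R[i], hence diagonalizable with
   real eigenvalues. *)
Lemma splits_char_poly_sym {n} (M : 'M[R]_n) : M^T = M -> splits (char_poly M).
Proof.
move=> Msym; pose f := [the {rmorphism R -> R[i]} of real_complex R].
have hN : map_mx f M \is hermsymmx.
  apply: realsym_hermsym; last first.
    by apply/mxOverP => i j; rewrite mxE; apply/complex_realP; exists (M i j).
  by apply/is_hermitianmxP; rewrite expr0 scale1r map_mx_id // map_trmx Msym.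
have /mxOverP dR := hermitian_spectral_diag_real hN.
have /orthomx_spectralP := hermitian_normalmx hN.
set P := spectralmx _; set d := spectral_diag _ => MD.
have uP : P \in unitmx by apply: spectral_unit.
have cM : char_poly (map_mx f M) = \prod_i ('X - (d 0 i)%:P).
  rewrite MD char_poly_conjmx // char_poly_trig ?diag_mx_is_trig //.
  by apply: eq_bigr => i _; rewrite mxE eqxx mulr1n.
exists [seq complex.Re (d 0 i) | i <- enum 'I_n].
apply: (@map_poly_inj _ _ f); rewrite map_char_poly cM rmorph_prod /=.
rewrite big_map big_enum /=; apply: eq_bigr => i _.
by rewrite rmorphB /= map_polyX map_polyC /= /f /= RRe_real.
Qed.

(** The product [(p - q) * g] vanishes everywhere, and characteristic 0 supplies more points than
    its degree allows as roots. A determinant may thus be computed pointwise with division by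
    anything that divides [g]. *)
Lemma poly_eq_off_roots p q g :
  g != 0 -> (forall x, g.[x] != 0 -> p.[x] = q.[x]) -> p = q.
Proof.
move=> g0 pq; apply/eqP; rewrite -subr_eq0.
suff: (p - q) * g == 0 by rewrite mulf_eq0 (negPf g0) orbF.
apply/eqP; set h := _ * g.
apply: (@roots_geq_poly_eq0 _ h [seq i%:R | i <- iota 0 (size h)]).
- apply/allP => x _; rewrite /root /h !hornerE.
  have [->|/pq->] := eqVneq g.[x] 0; first by rewrite mulr0.
  by rewrite subrr mul0r.
- by rewrite map_inj_uniq ?iota_uniq //; apply: mulrIn; rewrite oner_eq0.
- by rewrite size_map size_iota.
Qed.

Lemma horner_char_poly {F : comNzRingType} {n} (M : 'M[F]_n) x :
  (char_poly M).[x] = \det (x%:M - M).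
Proof.
rewrite /char_poly -horner_evalE -det_map_mx; congr (\det _).
apply/matrixP => i j; rewrite !mxE /=.
by rewrite horner_evalE !hornerE hornerMn hornerX.
Qed.

End Splitting.

(** * Determinant identities *)

Section Determinants.

(** Changing the enumeration of the index type permutes rows and columns by the same permutation, so
    the two signs cancel. *)
Lemma det_mx_bij {R : comNzRingType} {T : finType} {n} (f : 'I_n -> T)
    (F : T -> T -> R) :
  bijective f ->
  \det (\matrix_(i, j) F (f i) (f j))
  = \det (\matrix_(i < #|T|, j < #|T|) F (enum_val i) (enum_val j)).
Proof.
move=> bf; have e : #|T| = n by rewrite -(bij_eq_card bf) card_ord.
case: n / e f bf => f bf; pose g i := enum_rank (f i).
have ginj : injective g by move=> i j /enum_rank_inj /(bij_inj bf).
set B := (X in _ = \det X); pose s := perm.perm ginj.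
have -> : \matrix_(i, j) F (f i) (f j) = row_perm s (col_perm s B).
  by apply/matrixP => i j; rewrite !mxE !perm.permE !enum_rankK.
rewrite row_permE col_permE !det_mulmx !det_perm perm.odd_permV.
by rewrite mulrCA -signr_addb addbb mulr1.
Qed.

(** Both sides are the determinant of the block matrix with rows [1, -X] and [Y, 1], factored into
    triangular matrices in two ways. *)
Lemma det_sylvester {R : comNzRingType} {m n} (X : 'M[R]_(m, n))
    (Y : 'M[R]_(n, m)) :
  \det (1%:M + X *m Y) = \det (1%:M + Y *m X).
Proof.
have h1 : \det (block_mx 1%:M (- X) Y 1%:M) = \det (1%:M + Y *m X).
  have -> : block_mx 1%:M (- X) Y 1%:M =
    block_mx 1%:M 0 Y 1%:M *m block_mx 1%:M (- X) 0 (1%:M + Y *m X).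
    rewrite mulmx_block !mul0mx !mul1mx !mulmx1 !addr0 mulmxN.
    by rewrite addrC addrK.
  by rewrite det_mulmx det_lblock det_ublock !det1 !mul1r.
rewrite -h1; have -> : block_mx 1%:M (- X) Y 1%:M =
    block_mx 1%:M (- X) 0 1%:M *m block_mx (1%:M + X *m Y) 0 Y 1%:M.
  by rewrite mulmx_block !mul0mx !mul1mx !mulmx1 !add0r mulNmx addrK.
by rewrite det_mulmx det_lblock det_ublock !det1 !mul1r mulr1.
Qed.

(** Factor [S] out on the left and apply Sylvester's identity: a perturbation of rank at most [n]
    costs only an [n] by [n] determinant. *)
Lemma det_update {F : comNzRingType} {m n} (S S' : 'M[F]_m)
    (X : 'M[F]_(m, n)) (Y : 'M[F]_(n, m)) :
  S *m S' = 1%:M ->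
  \det (S + X *m Y) = \det S * \det (1%:M + Y *m S' *m X).
Proof.
move=> SS'; rewrite -mulmxA -det_sylvester -det_mulmx mulmxDr mulmx1.
by rewrite !mulmxA SS' mul1mx.
Qed.

Lemma det_mx33 {R : comNzRingType} (A : 'M[R]_3) :
  \det A = A 0 0 * (A 1 1 * A 2%:R 2%:R - A 1 2%:R * A 2%:R 1)
         - A 0 1 * (A 1 0 * A 2%:R 2%:R - A 1 2%:R * A 2%:R 0)
         + A 0 2%:R * (A 1 0 * A 2%:R 1 - A 1 1 * A 2%:R 0).
Proof.
(* Entries named by natural numbers let [ring] identify ordinals that the cofactor expansion writes
   in different ways. *)
pose a (i j : nat) := A (inord i) (inord j).
have aE i j : A i j = a i j by rewrite /a !inord_val.
rewrite (expand_det_row _ 0) !big_ord_recl big_ord0 /cofactor.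
rewrite !(expand_det_row _ 0) !big_ord_recl !big_ord0 /cofactor !det_mx11 !mxE.
by rewrite !aE /= /bump /=; ring.
Qed.

(** For [l != 0] this is [l ^+ n] times the characteristic polynomial at [k / l]; for [l = 0] the
    matrix is scalar. *)
Lemma det_scalar_sub {F : fieldType} {n} (B : 'M[F]_n) (s : seq F) (k l : F) :
  char_poly B = \prod_(x <- s) ('X - x%:P) ->
  \det (k%:M - l *: B) = \prod_(x <- s) (k - l * x).
Proof.
move=> cB; have ns : n = size s.
  by have := congr1 (fun p : {poly F} => size p) cB;
    rewrite size_char_poly size_prod_XsubC => -[].
have [->|l0] := eqVneq l 0.
  rewrite scale0r subr0 det_scalar ns.
  under eq_bigr => x _ do rewrite mul0r subr0.
  by rewrite big_const_seq count_predT iter_mulr_1.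
have -> : k%:M - l *: B = l *: ((k / l)%:M - B).
  by rewrite scalerBr -scalemx1 scalerA mulrC divfK // scalemx1.
rewrite detZ -horner_char_poly cB horner_prod ns.
have -> : l ^+ size s = \prod_(x <- s) l.
  by rewrite big_const_seq count_predT iter_mulr_1.
rewrite -big_split /=; apply: eq_bigr => x _.
by rewrite !hornerE mulrBr mulrC divfK.
Qed.

End Determinants.

(** * Counting incidences between vertices and edges *)

Section Incidence.
Context {V : finType} (G : sgraph V).
Implicit Types (x y : V) (e f : edge G).

Lemma degreeE x : degree G x = (\sum_y G x y)%N.
Proof.
rewrite /degree -sum1_card big_mkcond; apply: eq_bigr => y _.
by rewrite inE; case: (G x y).
Qed.

Lemma edgeP e : exists x y, [/\ G x y, x != y & val e = [set x; y]].
Proof.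
have := valP e; rewrite inE => /existsP[x /existsP[y /andP[Gxy /eqP ->]]].
exists x, y; split=> //; apply/eqP => xy.
by move: Gxy; rewrite xy adj_irr.
Qed.

Lemma sum_memE (A : {set V}) : (\sum_x (x \in A))%N = #|A|.
Proof.
by rewrite -sum1_card [RHS]big_mkcond; apply: eq_bigr => x _; case: ifP.
Qed.

Lemma card_edge e : #|val e| = 2%N.
Proof. by have [x [y [_ xy ->]]] := edgeP e; rewrite cards2 xy. Qed.

Lemma edge_eq_set2 x y e :
  x != y -> x \in val e -> y \in val e -> val e = [set x; y].
Proof.
move=> xy xe ye; apply/esym/eqP; rewrite eqEcard card_edge cards2 xy andbT.
by apply/subsetP => z; rewrite !inE => /orP[] /eqP->.
Qed.

(** An edge containing two distinct vertices is the pair of them, so there is one such edge or none.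
    These are the off-diagonal entries of the incidence matrix times its transpose. *)
Lemma sum_edges_mem2 x y :
  x != y -> (\sum_(e : edge G) (x \in val e) * (y \in val e))%N = G x y.
Proof.
move=> xy; have [Gxy|nGxy] := boolP (G x y); last first.
  rewrite big1 // => e _; case: (boolP (x \in val e)) => // xe.
  case: (boolP (y \in val e)) => // ye; case/negP: nGxy.
  have [u [v [Guv _ euv]]] := edgeP e.
  move: xe ye; rewrite euv !inE => /orP[] /eqP ex /orP[] /eqP ey.
  - by move: xy; rewrite ex ey eqxx.
  - by rewrite ex ey.
  - by rewrite ex ey adj_sym.
  - by move: xy; rewrite ex ey eqxx.
have h : [set x; y] \in edges G.
  rewrite inE; apply/existsP; exists x; apply/existsP; exists y.
  by rewrite Gxy /=.
pose e0 : edge G := Sub [set x; y] h.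
rewrite (bigD1 e0) //= !inE !eqxx orbT big1 // => e ne.
case: (boolP (x \in val e)) => // xe; case: (boolP (y \in val e)) => // ye.
by case/negP: ne; apply/eqP/val_inj; rewrite /= (edge_eq_set2 _ _ e xy xe ye).
Qed.

(** Each edge at [x] has exactly one other end [y]; exchanging the sums over edges and over [y]
    counts neighbours. *)
Lemma sum_edges_mem x : (\sum_(e : edge G) (x \in val e))%N = degree G x.
Proof.
transitivity
  (\sum_(e : edge G) \sum_(y | y != x) (x \in val e) * (y \in val e))%N.
  apply: eq_bigr => e _; rewrite -big_distrr /=.
  case: (boolP (x \in val e)) => xe; last by rewrite mul0n.
  have := card_edge e; rewrite -sum_memE (bigD1 x) //= xe mul1n add1n.
  by case=> ->.
rewrite exchange_big degreeE [RHS](bigD1 x) //= adj_irr add0n.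
by apply: eq_bigr => y yx; rewrite sum_edges_mem2 // eq_sym.
Qed.

(** Distinct edges share at most one vertex, so the size of their intersection is the adjacency
    indicator; for [e = f] the size is 2. *)
Lemma sum_vertices_mem2 e f :
  (\sum_x (x \in val e) * (x \in val f))%N
  = ((e == f) * 2 + ((e != f) && (val e :&: val f != set0)))%N.
Proof.
transitivity #|val e :&: val f|.
  by rewrite -sum_memE; apply: eq_bigr => x _; rewrite inE mulnb.
have [->|nef] := eqVneq e f; first by rewrite setIid card_edge.
rewrite mul0n add0n andTb -card_gt0.
suff : (#|val e :&: val f| < 2)%N.
  by case: #|_| => [|[|k]].
(* With two common vertices, both edges would equal their intersection. *)
rewrite ltnNge; apply: contra nef => h; apply/eqP/val_inj.
have /eqP <- : val e :&: val f == val e.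
  by rewrite eqEcard subsetIl card_edge.
by apply/eqP; rewrite eqEcard subsetIr card_edge.
Qed.

(** Count pairs of a vertex of [e] and an edge through it: [e] occurs twice, each adjacent edge
    once. The right-hand side is the degree of the inserted vertex in the $Q$-graph. *)
Lemma sum_edge_degree e :
  (\sum_(x in val e) degree G x
   = \sum_x (x \in val e)
     + \sum_(f : edge G) ((e != f) && (val e :&: val f != set0)))%N.
Proof.
rewrite sum_memE card_edge.
transitivity (\sum_(f : edge G) \sum_x (x \in val e) * (x \in val f))%N.
  rewrite exchange_big big_mkcond; apply: eq_bigr => x _ /=.
  rewrite -big_distrr /= sum_edges_mem.
  by case: (x \in _); rewrite ?mul1n ?mul0n.
under eq_bigr do rewrite sum_vertices_mem2.
rewrite big_split /= -big_distrl /= (bigD1 e) //= eqxx big1 ?addn0 //.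
by move=> f /negPf; rewrite eq_sym => ->.
Qed.

(** Incidences are counted by edges and by vertices. This fixes the size for degree 1 and bounds it
    below by the order for degree at least 2. *)
Lemma regular_handshake t :
  regular t G -> (2 * gsize G = gorder G * t)%N.
Proof.
move=> hreg; rewrite /gsize /gorder.
transitivity (\sum_(e : edge G) \sum_x (x \in val e))%N.
  under eq_bigr do rewrite sum_memE card_edge.
  by rewrite sum_nat_const card_sig mulnC.
rewrite exchange_big /=; under eq_bigr do rewrite sum_edges_mem hreg.
by rewrite sum_nat_const.
Qed.

End Incidence.

(** * Vertex degrees in the join *)

Section JoinDegrees.
Context {V1 V2 : finType} (G1 : sgraph V1) (G2 : sgraph V2).
Let J := qvjoin G1 G2.

Lemma degree_join_vertex x :
  degree J (inl (inl x)) = (degree G1 x + #|V2|)%N.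
Proof.
rewrite degreeE !big_sumType /= big1 // add0n sum_edges_mem.
by rewrite sum_nat_const muln1.
Qed.

Lemma degree_join_edge t (e : edge G1) : regular t G1 ->
  degree J (inl (inr e)) = (2 * t)%N.
Proof.
move=> hreg; rewrite degreeE !big_sumType /= [X in (_ + X)%N]big1 // addn0.
rewrite -sum_edge_degree; under eq_bigr do rewrite hreg.
by rewrite sum_nat_const card_edge.
Qed.

Lemma degree_join_right y :
  degree J (inr y) = (#|V1| + degree G2 y)%N.
Proof.
rewrite degreeE !big_sumType /= [X in (_ + X + _)%N]big1 // addn0.
by rewrite sum_nat_const muln1 degreeE.
Qed.

Lemma degree_Kbip_inl a b i : degree (Kbip a b) (inl i) = b.
Proof.
by rewrite degreeE big_sumType /= big1 // sum_nat_const card_ord muln1.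
Qed.

Lemma degree_Kbip_inr a b i : degree (Kbip a b) (inr i) = a.
Proof.
rewrite degreeE big_sumType /= [X in (_ + X)%N]big1 //.
by rewrite sum_nat_const card_ord muln1 addn0.
Qed.

End JoinDegrees.

(** * Connected 1-regular graphs *)

Section MatchingGraph.
Context {V : finType} (G : sgraph V).

(** A vertex and its only neighbour form a set closed under adjacency, which connectedness makes the
    whole graph. The coefficients of the formulas for degree 1 are those of order 2. *)
Lemma connected_1regular_order :
  regular 1 G -> connected G -> (0 < gorder G)%N -> gorder G = 2%N.
Proof.
move=> hreg hc /card_gt0P[x _].
have /eqP/cards1P[y Ny] := hreg x.
have Gxy : G x y by have := set11 y; rewrite -Ny inE.
have xy : x != y by apply/eqP => e; move: Gxy; rewrite e adj_irr.
have Ny' : [set z | G y z] = [set x].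
  have /eqP/cards1P[z Nz] := hreg y.
  rewrite Nz; congr [set _]; apply/esym/eqP.
  by rewrite -in_set1 -Nz inE adj_sym.
have cl : closed G [set x; y].
  apply: intro_closed; first exact/sym_connect_sym/adj_sym.
  move=> u v Guv; rewrite !inE => /orP[] /eqP uE; move: Guv; rewrite uE.
    by move=> Gxv; rewrite -[v == y]in_set1 -Ny inE Gxv orbT.
  by move=> Gyv; rewrite -[v == x]in_set1 -Ny' inE Gyv.
have all2 z : z \in [set x; y].
  by rewrite -(closed_connect cl (hc x z)) !inE eqxx.
by rewrite /gorder -(eq_card all2) cards2 xy.
Qed.

End MatchingGraph.

(** * Eliminating the edge block *)

Section Elimination.

(** Column operations replace the Schur complement: nothing is divided by [q], so the identity also
    holds where [q] vanishes. *)
Lemma det_eliminate_edges {R : comNzRingType} {m n k} (p q c : R)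
    (B : 'M[R]_(n, m)) (C : 'M[R]_(n, k)) (D : 'M[R]_(k, n)) (N : 'M[R]_k) :
  q ^+ n * \det (block_mx (q%:M - c *: (B^T *m B)) (row_mx (- c *: B^T) 0)
                          (col_mx (- c *: B) 0) (block_mx p%:M C D N))
  = q ^+ m * \det (block_mx ((p * q)%:M - (c * (c + p)) *: (B *m B^T)) C
                            (q *: D - c *: (D *m B *m B^T)) N).
Proof.
set M := (X in _ * \det X = _).
(* Subtracting the vertex columns times [B] from the edge columns turns the edge block into the
   scalar [q]. *)
pose T1 : 'M[R]_(m + (n + k)) := block_mx 1%:M 0 (col_mx (- B) 0) 1%:M.
(* Scaling the vertex columns by [q] and adding [c] times the edge columns times [B^T] then clears
   the block above the diagonal. *)
pose T2 : 'M[R]_(m + (n + k)) :=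
  block_mx 1%:M (row_mx (c *: B^T) 0) 0 (block_mx q%:M 0 0 1%:M).
have dT1 : \det T1 = 1 by rewrite det_lblock !det1 mul1r.
have dT2 : \det T2 = q ^+ n.
  by rewrite det_ublock det_ublock !det1 mul1r mulr1 det_scalar.
have MT : M *m T1 *m T2 = block_mx q%:M 0
    (col_mx (- (c + p) *: B) (- (D *m B)))
    (block_mx ((p * q)%:M - (c * (c + p)) *: (B *m B^T)) C
       (q *: D - c *: (D *m B *m B^T)) N).
  rewrite /M /T1 /T2 !mulmx_block ?mulmx0 ?mul0mx ?mulmx1 ?mul1mx ?add0r ?addr0.
  have -> : q%:M - c *: (B^T *m B) + row_mx (- c *: B^T) (0 : 'M_(m, k)) *m
            col_mx (- B) 0 = q%:M.
    rewrite mul_row_col mul0mx addr0 -scalemxAl mulmxN scalerN scaleNr opprK.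
    by rewrite subrK.
  have -> : col_mx (- c *: B) 0 + block_mx p%:M C D N *m col_mx (- B) 0
            = col_mx (- (c + p) *: B) (- (D *m B)).
    rewrite mul_block_col !mulmx0 !addr0 add_col_mx add0r mulmxN.
    by rewrite mul_scalar_mx -scaleNr -scalerDl -opprD mulmxN.
  rewrite mul_row_block mul_mx_row mul_col_row mulmx_block add_block_mx.
  rewrite ?mulmx0 ?mul0mx ?mulmx1 ?mul1mx ?add0r ?addr0.
  rewrite add_row_mx addr0 !mul_mx_scalar !mul_scalar_mx.
  congr block_mx; last congr block_mx.
  - by rewrite !scalerA mulrN scaleNr subrr row_mx0.
  - rewrite -scalemxAl -scalemxAr scalerA scale_scalar_mx addrC mulNr.
    by rewrite scaleNr (mulrC q) (mulrC c).
  - by rewrite -scalemxAr mulNmx scalerN addrC.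
have := congr1 (fun X => \det X) MT.
rewrite /= !det_mulmx dT1 dT2 mulr1 mulrC => ->.
by rewrite det_lblock det_scalar.
Qed.

End Elimination.

(** * Reduction of a three-part block determinant to a 3 by 3 one *)

Section Quotient.
Variables (F : fieldType) (n a b : nat) (H : 'M[F]_n) (h y z c r : F).
Hypotheses (uH : H \in unitmx) (h0 : h != 0) (y0 : y != 0) (z0 : z != 0).
Hypothesis H1 : H *m const_mx 1 = const_mx h :> 'cV_n.

(* The matrix below is block diagonal plus blocks [w k l] times an all-ones
   matrix; index 0 is the block [H], 1 and 2 are the parts of K_{a,b}. *)
Let w (k l : 'I_3) : F :=
  if k == l then 0 else if (k != 0) && (l == 0) then - (c * r) else - c.
Let D {p} (l : 'I_3) : 'M[F]_(p, 3) := \matrix_(_, j) (j == l)%:R.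
Let W {p} (l : 'I_3) : 'M[F]_(3, p) := \matrix_(k, _) w k l.

Let mulDW {p q} k l : D k *m W l = const_mx (w k l) :> 'M_(p, q).
Proof.
apply/matrixP => i j; rewrite !mxE (bigD1 k) //= !mxE eqxx mul1r.
by rewrite big1 ?addr0 // => s /negPf sk; rewrite !mxE sk mul0r.
Qed.

Let mulWD {p} l :
  W l *m (D l : 'M_(p, 3)) = \matrix_(k, j) (p%:R * w k l * (j == l)%:R).
Proof.
apply/matrixP => i j; rewrite !mxE.
under eq_bigr do rewrite !mxE.
by rewrite sumr_const card_ord -mulrA mulr_natl.
Qed.

(** The off-diagonal blocks have the form [X *m Y] of inner dimension 3, and [H] enters the update
    formula only through its value [h] on the all-ones vector. The factor [h * y * z] clears
    denominators; [r] records the asymmetry left by the column operations. *)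
Lemma det_three_parts :
  h * y * z * \det (block_mx H (- c *: const_mx 1) (- (c * r) *: const_mx 1)
     (block_mx y%:M (- c *: const_mx 1) (- c *: const_mx 1) z%:M)
     : 'M_(n + (a + b)))
  = \det H * y ^+ a * z ^+ b *
    (h * (y * z - c ^+ 2 * a%:R * b%:R)
     - c ^+ 2 * r * n%:R * (a%:R * z + b%:R * y + 2 * c * a%:R * b%:R)).
Proof.
pose S : 'M[F]_(n + (a + b)) := block_mx H 0 0 (block_mx y%:M 0 0 z%:M).
pose S' : 'M[F]_(n + (a + b)) :=
  block_mx (invmx H) 0 0 (block_mx (y^-1)%:M 0 0 (z^-1)%:M).
have SS' : S *m S' = 1%:M.
  rewrite /S /S' !mulmx_block ?mulmx0 ?mul0mx ?add0r ?addr0 mulmxV //.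
  by rewrite -!scalar_mxM !divff // -!scalar_mx_block.
pose X : 'M[F]_(n + (a + b), 3) := col_mx (D 0) (col_mx (D 1) (D 2%:R)).
pose Y : 'M[F]_(3, n + (a + b)) := row_mx (W 0) (row_mx (W 1) (W 2%:R)).
have -> : block_mx H (- c *: const_mx 1) (- (c * r) *: const_mx 1)
     (block_mx y%:M (- c *: const_mx 1) (- c *: const_mx 1) z%:M) = S + X *m Y.
  rewrite /X /Y !mul_col_row mul_col_mx mul_mx_row !mulDW /S.
  rewrite !add_block_mx /w /= !add0r row_mx_const col_mx_const.
  by rewrite !addr0 !scalemx_const !mulr1.
have HD : invmx H *m D 0 = h^-1 *: D 0.
  have D0 : D 0 = const_mx 1 *m (delta_mx 0 0 : 'rV_3) :> 'M_(n, 3).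
    by apply/matrixP => i j; rewrite !mxE big_ord1 !mxE mul1r eqxx.
  apply: (can_inj (mulKmx uH)); rewrite mulKVmx // -scalemxAr D0 mulmxA H1.
  by rewrite scalemxAl scalemx_const mulVf.
(* Column [j] is weighted by the size of part [j] over the scalar by which its diagonal block acts
   on the all-ones vector. *)
have YX : Y *m S' *m X = \matrix_(k, j) (w k j *
     (if j == 0 then n%:R / h else if j == 1 then a%:R / y else b%:R / z)).
  rewrite /Y /S' /X !mul_row_block mul_row_col ?mulmx0 ?addr0 ?add0r.
  rewrite mul_row_col -!mulmxA HD !mul_scalar_mx.
  rewrite -!scalemxAr !mulWD; apply/matrixP => k j; rewrite !mxE.
  suff: j = 0 \/ j = 1 \/ j = 2%:R.
    by case=> [->|[->|->]]; rewrite ?eqxx /=; ring.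
  case: j => [[|[|[|//]]]] ?; [left|right; left|right; right];
  exact: val_inj.
rewrite (det_update _ _ _ _ SS') YX /S det_ublock det_ublock !det_scalar.
rewrite det_mx33 !mxE /w /=.
by field; rewrite h0 y0 z0.
Qed.
End Quotient.

(** * The matrix [Aalpha] of a regular graph, its incidence matrix and its largest eigenvalue *)

Section AalphaRegular.
Variables (R : rcfType) (alpha : R) (V : finType) (G : sgraph V) (t : nat).
Hypotheses (halpha : 0 <= alpha <= 1) (hreg : regular t G).
Let A := Aalpha G alpha.

Definition incidence_mx : 'M[R]_(#|V|, #|edge G|) :=
  \matrix_(i, j) (enum_val i \in val (enum_val j : edge G))%:R.

Lemma AalphaE i j : A i j =
  alpha * t%:R *+ (i == j) + (1 - alpha) * (G (enum_val i) (enum_val j))%:R.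
Proof.
by rewrite !mxE hreg (mulrnAr alpha t%:R).
Qed.

Lemma Aalpha_sym {W : finType} (K : sgraph W) :
  (Aalpha K alpha)^T = Aalpha K alpha.
Proof.
apply/matrixP => i j; rewrite !mxE eq_sym (adj_sym K).
by case: eqP => [->|]; rewrite ?mulr0n.
Qed.

Lemma row_sum_Aalpha i : \sum_j A i j = t%:R.
Proof.
under eq_bigr do rewrite AalphaE.
rewrite big_split /= -big_distrr /= (bigD1 i) //= eqxx big1 ?addr0; last first.
  by move=> j /negPf; rewrite eq_sym => ->.
rewrite -natr_sum -(@big_enum_val _ _ _ V predT
  (fun y => nat_of_bool (G (enum_val i) y))) -degreeE hreg.
by rewrite mulr1n; ring.
Qed.

Lemma Aalpha_const1 : A *m const_mx 1 = const_mx t%:R :> 'cV_ _.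
Proof.
apply/matrixP => i j; rewrite !mxE -(row_sum_Aalpha i).
by apply: eq_bigr => k _; rewrite [X in _ * X]mxE mulr1.
Qed.

(** Combine $BB^T = A(G) + t$ with $A_\alpha = \alpha t + (1-\alpha)A(G)$. Keeping the factor
    [1 - alpha] on the left covers [alpha = 1]. *)
Lemma incidence_mul_tr :
  (1 - alpha) *: (incidence_mx *m incidence_mx^T)
  = A + ((1 - 2 * alpha) * t%:R)%:M.
Proof.
apply/matrixP => i j; rewrite mxE [RHS]mxE AalphaE !mxE.
under eq_bigr do rewrite !mxE -natrM.
rewrite -natr_sum -(@big_enum_val _ _ _ (edge G) predT (fun e : edge G =>
  ((enum_val i \in val e) * (enum_val j \in val e))%N)) /=.
have [->|ij] := eqVneq i j.
  rewrite (eq_bigr (fun e : edge G => nat_of_bool (enum_val j \in val e))).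
    by rewrite sum_edges_mem hreg adj_irr !mulr1n mulr0n; ring.
  by move=> e _; rewrite mulnb andbb.
rewrite sum_edges_mem2 ?(inj_eq enum_val_inj) // !mulr0n; ring.
Qed.

Lemma incidence_tr_mul i j :
  (incidence_mx^T *m incidence_mx) i j
  = 2 *+ (i == j) +
    ((enum_val i != enum_val j) &&
     (val (enum_val i : edge G) :&: val (enum_val j : edge G) != set0))%:R.
Proof.
rewrite !mxE; under eq_bigr do rewrite !mxE -natrM.
rewrite -natr_sum -(@big_enum_val _ _ _ V predT (fun x =>
  ((x \in val (enum_val i : edge G))
   * (x \in val (enum_val j : edge G)))%N)) /=.
rewrite sum_vertices_mem2 (inj_eq enum_val_inj) natrD natrM.
by rewrite mulr_natl.
Qed.

Lemma const1_incidence k :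
  (const_mx 1 : 'M_(k, _)) *m incidence_mx = const_mx 2.
Proof.
apply/matrixP => i j; rewrite !mxE; under eq_bigr do rewrite !mxE mul1r.
rewrite -natr_sum -(@big_enum_val _ _ _ V predT (fun x =>
  nat_of_bool (x \in val (enum_val j : edge G)))) /=.
by rewrite sum_memE card_edge.
Qed.

Lemma const1_incidence_tr k :
  (const_mx 1 : 'M_(k, _)) *m incidence_mx^T = const_mx t%:R.
Proof.
apply/matrixP => i j; rewrite !mxE; under eq_bigr do rewrite !mxE mul1r.
rewrite -natr_sum -(@big_enum_val _ _ _ (edge G) predT (fun e : edge G =>
  nat_of_bool (enum_val j \in val e))) /=.
by rewrite sum_edges_mem hreg.
Qed.

Lemma char_poly_Aalpha :
  char_poly A = \prod_(x <- sort >=%R (spectrum A)) ('X - x%:P).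
Proof.
rewrite (perm_big (spectrum A)) ?perm_sort //= prod_mroots //.
exact/splits_char_poly_sym/Aalpha_sym.
Qed.

Lemma eigenvalue_spectrum x : (x \in spectrum A) = eigenvalue A x.
Proof.
have sA : splits R (char_poly A) by apply/splits_char_poly_sym/Aalpha_sym.
by rewrite eigenvalue_root_char -(prod_mroots R _ sA) root_prod_XsubC.
Qed.

(* Look at a coordinate of maximum modulus of an eigenvector: [A] is
   nonnegative with row sums [t]. *)
Lemma eigenvalue_Aalpha_le x : eigenvalue A x -> x <= t%:R.
Proof.
case/eigenvalueP => v vA v0.
have Ag0 i j : 0 <= A i j.
  have /andP[a0 a1] := halpha.
  by rewrite AalphaE addr_ge0 ?mulrn_wge0 ?mulr_ge0 ?subr_ge0.
have /rV0Pn[k vk] := v0.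
case: (arg_maxP (fun j => `|v 0 j|) (erefl : xpredT k)) => i _ imax.
have vi : 0 < `|v 0 i| by rewrite (lt_le_trans _ (imax k _)) // normr_gt0.
rewrite -(ler_pM2r vi); apply: le_trans (ler_norm _) _.
rewrite normrM normr_id.
rewrite -normrM; have -> : x * v 0 i = (x *: v) 0 i by rewrite mxE.
rewrite -vA mxE; apply: le_trans (ler_norm_sum _ _ _) _.
rewrite -(row_sum_Aalpha i) mulr_suml; apply: ler_sum => j _.
have -> : A i j = A j i by rewrite /A -{1}(Aalpha_sym G) mxE.
rewrite normrM (ger0_norm (Ag0 j i)) mulrC ler_wpM2l //; exact: imax.
Qed.

Lemma eigenvalue_Aalpha_degree : (0 < #|V|)%N -> eigenvalue A t%:R.
Proof.
move=> V0; apply/eigenvalueP; exists (const_mx 1).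
  apply: trmx_inj; rewrite trmx_mul Aalpha_sym trmx_const Aalpha_const1.
  by apply/matrixP => i j; rewrite !mxE mulr1.
apply/rV0Pn; exists (Ordinal V0); rewrite mxE; exact: oner_neq0.
Qed.

(** The degree is an eigenvalue and bounds all others, so it heads the decreasing list; [behead]
    then holds the eigenvalues of index at least 2. *)
Lemma sort_spectrum_Aalpha : (0 < #|V|)%N ->
  sort >=%R (spectrum A) = t%:R :: behead (sort >=%R (spectrum A)).
Proof.
move=> V0; set s := sort _ _.
have ts : t%:R \in s.
  by rewrite mem_sort eigenvalue_spectrum eigenvalue_Aalpha_degree.
have sle x : x \in s -> x <= t%:R.
  by rewrite mem_sort eigenvalue_spectrum; apply: eigenvalue_Aalpha_le.
have : sorted >=%R s by apply: sort_sorted => x y; apply: le_total.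
case: s ts sle => // x s ts sle /= px; congr (_ :: _); apply: le_anti.
rewrite sle ?mem_head //=; move: ts; rewrite inE => /predU1P[->//|ts].
move: px; rewrite path_sortedE; first by case/andP => /allP/(_ _ ts).
by move=> a b c /= h1 h2; apply: le_trans h2 h1.
Qed.

End AalphaRegular.

(** * The quadratic and quartic factors *)

Section JoinFactors.
Variables (R : rcfType) (alpha : R) (t n1 n2 a b : nat).

Definition join_quadratic (lam : R) : {poly R} :=
  'X^2 - (t%:R - 2 + lam + alpha * (2 + t%:R + n2%:R)) *: 'X
  - (2 * alpha * (1 - alpha) * n2%:R)%:P
  - ((1 - alpha * (1 + t%:R + n2%:R)) * (t%:R + lam))%:P.

(** The first factor is [join_quadratic] at the eigenvalue [t], the second comes from the two parts
    of $K_{a,b}$, and the subtracted term couples them. *)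
Definition join_quartic : {poly R} :=
  ('X^2 - (alpha * t%:R + alpha * n2%:R + 2 * alpha + 2 * t%:R - 2) *: 'X
    + (2 * alpha ^+ 2 * n2%:R + 2 * alpha * t%:R ^+ 2
       + 2 * alpha * t%:R * n2%:R + 2 * alpha * t%:R
       - 2 * alpha * n2%:R - 2 * t%:R)%:P)
  * ('X^2 - (alpha * (2 * n1%:R + n2%:R)) *: 'X
    + (alpha ^+ 2 * n1%:R ^+ 2 + alpha ^+ 2 * n1%:R * n2%:R
       + 2 * alpha * a%:R * b%:R - a%:R * b%:R)%:P)
  - (n1%:R * (1 - alpha) ^+ 2) *:
    (('X + (2 - 2 * alpha - 2 * t%:R)%:P)
     * (n2%:R *: ('X - (alpha * n1%:R)%:P)
        - (alpha * n2%:R ^+ 2)%:P + (2 * a%:R * b%:R)%:P)).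

Lemma monic_sizeD (p q : {poly R}) k : p \is monic -> size p = k ->
  (size q < k)%N -> p + q \is monic /\ size (p + q) = k.
Proof.
by move=> pm sp sq; rewrite monicE lead_coefDl ?size_polyDl ?sp.
Qed.

Lemma size_linear_le (u v : R) : (size (u *: 'X + v%:P)%R <= 2)%N.
Proof.
rewrite (leq_trans (size_polyD _ _)) // geq_max.
rewrite (leq_trans (size_scale_leq _ _)) ?size_polyX //.
exact: leq_trans (size_polyC_leq1 _) _.
Qed.

Lemma monic_quadratic (u v : R) : 'X^2 - u *: 'X + v%:P \is monic
  /\ size ('X^2 - u *: 'X + v%:P) = 3%N.
Proof.
rewrite -scaleNr -addrA.
by apply: monic_sizeD; rewrite ?monicXn ?size_polyXn // ltnS size_linear_le.
Qed.

Lemma join_quadratic_monic lam :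
  join_quadratic lam \is monic /\ size (join_quadratic lam) = 3%N.
Proof.
by rewrite /join_quadratic -addrA -!polyCN -polyCD; apply: monic_quadratic.
Qed.

Lemma join_quartic_monic :
  join_quartic \is monic /\ size join_quartic = 5%N.
Proof.
have qm (u v : R) : 'X^2 - u *: 'X + v%:P \is monic.
  by case: (monic_quadratic u v).
have qs (u v : R) : size ('X^2 - u *: 'X + v%:P) = 3%N.
  by case: (monic_quadratic u v).
have sizeM (u1 v1 u2 v2 : R) :
  (size ((u1 *: 'X + v1%:P) * (u2 *: 'X + v2%:P))%R <= 3)%N.
  apply: leq_trans (size_polyMleq _ _) _.
  by have := size_linear_le u1 v1; have := size_linear_le u2 v2; lia.
apply: monic_sizeD.
- by rewrite monicMl qm.
- by rewrite size_monicM ?qm ?monic_neq0 ?qm // !qs.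
rewrite size_polyN (leq_ltn_trans (size_scale_leq _ _)) // ltnS.
rewrite -[X in (X + _) * _]scale1r.
have -> : n2%:R *: ('X - (alpha * n1%:R)%:P) - (alpha * n2%:R ^+ 2)%:P
    + (2 * a%:R * b%:R)%:P = n2%:R *: 'X
    + (2 * a%:R * b%:R - alpha * n2%:R ^+ 2 - n2%:R * (alpha * n1%:R))%:P.
  by rewrite -!mul_polyC !(polyCD, polyCN, polyCM); ring.
exact: leq_trans (sizeM _ _ _ _) _.
Qed.

End JoinFactors.

(** * The characteristic polynomial of the join *)

Section JoinCharPoly.
Variables (R : rcfType) (alpha : R) (V : finType) (G : sgraph V) (t a b : nat).
Hypotheses (halpha : 0 <= alpha <= 1) (hreg : regular t G).
Let n := #|V|.
Let m := #|edge G|.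
Let n2 : R := (a + b)%:R.
Let J := qvjoin G (Kbip a b).
Let B := incidence_mx R _ G.
Let s := sort >=%R (spectrum (Aalpha G alpha)).

Definition join_index (i : 'I_(m + (n + (a + b)))) :
    ((V + edge G) + ('I_a + 'I_b))%type :=
  match split i with
  | inl j => inl (inr (enum_val j))
  | inr j => match split j with
             | inl k => inl (inl (enum_val k))
             | inr k => inr (split k)
             end
  end.

Lemma join_index_bij : bijective join_index.
Proof.
exists (fun u => match u with
  | inl (inr e) => lshift _ (enum_rank e)
  | inl (inl x) => rshift _ (lshift _ (enum_rank x))
  | inr k => rshift _ (rshift _ (unsplit k))
  end) => [i|[[x|e]|k]]; rewrite /join_index.
- case: (split_ordP i) => j ->; first by rewrite enum_valK.
  by case: (split_ordP j) => k -> ; rewrite ?enum_valK ?splitK.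
- by rewrite (unsplitK (inr _)) (unsplitK (inl _)) enum_rankK.
- by rewrite (unsplitK (inl _)) enum_rankK.
- by rewrite (unsplitK (inr _)) (unsplitK (inr _)) unsplitK.
Qed.

(** Inserted vertices have degree [2 * t]; the extra [2 * (1 - alpha)] on their diagonal offsets the
    diagonal 2 of [B^T *m B]. *)
Lemma det_join x :
  (char_poly (Aalpha J alpha)).[x] =
  \det (block_mx
     ((x - 2 * alpha * t%:R + 2 * (1 - alpha))%:M - (1 - alpha) *: (B^T *m B))
     (row_mx (- (1 - alpha) *: B^T) 0) (col_mx (- (1 - alpha) *: B) 0)
     (block_mx (x - alpha * (t%:R + n2))%:M
        (- (1 - alpha) *: const_mx 1) (- (1 - alpha) *: const_mx 1)
        (block_mx (x - alpha * (n%:R + b%:R))%:M (- (1 - alpha) *: const_mx 1)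
           (- (1 - alpha) *: const_mx 1) (x - alpha * (n%:R + a%:R))%:M
           : 'M_(a + b)) : 'M_(n + (a + b)))).
Proof.
rewrite horner_char_poly.
pose F u v : R := (x - alpha * (degree J u)%:R) *+ (u == v)
                  - (1 - alpha) * (J u v)%:R.
have -> : x%:M - Aalpha J alpha
    = \matrix_(i, j) F (enum_val i) (enum_val j).
  apply/matrixP => i j; rewrite !mxE /F (inj_eq enum_val_inj).
  by case: (i == j); rewrite ?mulr1n ?mulr0n; ring.
rewrite -(det_mx_bij _ F join_index_bij); congr (\det _).
have fe i : join_index (lshift _ i) = inl (inr (enum_val i)).
  by rewrite /join_index (unsplitK (inl _)).
have fv i : join_index (rshift _ (lshift _ i)) = inl (inl (enum_val i)).
  by rewrite /join_index (unsplitK (inr _)) (unsplitK (inl _)).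
have fa i : join_index (rshift _ (rshift _ (lshift _ i))) = inr (inl i).
  by rewrite /join_index !(unsplitK (inr _)) (unsplitK (inl _)).
have fb i : join_index (rshift _ (rshift _ (rshift _ i))) = inr (inr i).
  by rewrite /join_index !(unsplitK (inr _)).
have VE : (#|{: 'I_a + 'I_b}|%:R : R) = n2 by rewrite card_sum !card_ord.
have Einl (T1 T2 : eqType) (u v : T1) :
  (inl u == inl v :> T1 + T2) = (u == v) by [].
have Einr (T1 T2 : eqType) (u v : T2) :
  (inr u == inr v :> T1 + T2) = (u == v) by [].
have entryE k (u c : R) (X : 'M_k) i j :
  (u%:M - c *: X) i j = u *+ (i == j) - c * X i j by rewrite !mxE.
apply/matrixP => i j; rewrite [LHS]mxE.
case: (split_ordP i) => {i} i ->; [|case: (split_ordP i) => {i} i ->;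
  [|case: (split_ordP i) => {i} i ->]];
(case: (split_ordP j) => {j} j ->; [|case: (split_ordP j) => {j} j ->;
  [|case: (split_ordP j) => {j} j ->]]);
rewrite ?(block_mxEul, block_mxEur, block_mxEdl, block_mxEdr, row_mxEl,
  row_mxEr, col_mxEu, col_mxEd) ?(fe, fv, fa, fb) /F
  ?(degree_join_vertex, degree_join_right, degree_Kbip_inl, degree_Kbip_inr)
  ?(degree_join_edge G (Kbip a b) t _ hreg) ?hreg ?natrM ?natrD ?VE.
  (* The edge-edge block is the one of the sixteen that involves the line graph. *)
  rewrite entryE incidence_tr_mul !Einl Einr; have [->|ij] := eqVneq i j.
    by rewrite /= !eqxx /= !mulr1n !mulr0n; ring.
  rewrite -(inj_eq enum_val_inj) in ij; rewrite /= !(negPf ij) /= !mulr0n; ring.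
all: rewrite !mxE ?(Einl, Einr) ?(inj_eq enum_val_inj) /= ?mulr0n.
all: try case: (i == j); rewrite ?mulr1n ?mulr0n -/n; ring.
Qed.

Lemma char_poly_join : (0 < n)%N -> (0 < a)%N -> (0 < b)%N ->
  ('X - (2 * alpha * (1 + t%:R) - 2)%:P) ^+ n * char_poly (Aalpha J alpha)
  = ('X - (2 * alpha * (1 + t%:R) - 2)%:P) ^+ m
    * (\prod_(x <- behead s) join_quadratic R alpha t (a + b) x)
    * ('X - (alpha * (n%:R + b%:R))%:P) ^+ (a - 1)
    * ('X - (alpha * (n%:R + a%:R))%:P) ^+ (b - 1)
    * join_quartic R alpha t n (a + b) a b.
Proof.
move=> n_gt0 a_gt0 b_gt0.
have sE : s = t%:R :: behead s by apply: sort_spectrum_Aalpha.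
(* The factors of [g] are what the computation divides by: the determinant of the vertex block after
   elimination and the diagonal scalars of the two parts of $K_{a,b}$. *)
pose g : {poly R} := (\prod_(x <- s) join_quadratic R alpha t (a + b) x)
  * ('X - (alpha * (n%:R + b%:R))%:P) * ('X - (alpha * (n%:R + a%:R))%:P).
apply: (poly_eq_off_roots _ _ _ g).
  rewrite !mulf_neq0 ?polyXsubC_eq0 //; apply: monic_neq0.
  by apply: monic_prod => x _; case: (join_quadratic_monic R alpha t (a + b) x).
move=> x; rewrite /g !(hornerM, horner_prod, hornerXsubC) !mulf_eq0 !negb_or.
case/andP=> /andP[qs0 y0] z0.
rewrite !(horner_exp, hornerXsubC) det_join.
pose c := 1 - alpha; rewrite -/c.
set p := x - alpha * (t%:R + n2).
have -> : x - (2 * alpha * (1 + t%:R) - 2) = x - 2 * alpha * t%:R + 2 * c.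
  by rewrite /c; ring.
set q := _ + 2 * c.
rewrite det_eliminate_edges.
(* By [incidence_mul_tr] the eliminated vertex block is [k - l * A] with [A] the matrix
   [Aalpha G alpha], and [h] is its value on the all-ones vector. *)
pose l := c + p; pose k := p * q - l * ((1 - 2 * alpha) * t%:R).
pose h := k - l * t%:R.
have quadE u : (join_quadratic R alpha t (a + b) u).[x] = k - l * u.
  rewrite /join_quadratic !(hornerD, hornerN, hornerXn, hornerZ, hornerX,
    hornerC).
  by rewrite /k /l /p /q /c /n2; ring.
have HE : (p * q)%:M - (c * (c + p)) *: (B *m B^T) = k%:M - l *: Aalpha G alpha.
  rewrite (mulrC c) -scalerA (incidence_mul_tr R alpha V G t hreg).
  rewrite scalerDr scale_scalar_mx.
  by rewrite opprD addrA addrAC -raddfB.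
(* An all-ones row times [B] and then [B^T] gains the factors 2 (ends of an edge) and [t] (edges at
   a vertex), so this block stays constant. *)
have DE : q *: (- c *: const_mx 1) - c *: ((- c *: const_mx 1) *m B *m B^T)
    = - (c * (q - c * (2 * t%:R))) *: const_mx 1 :> 'M[R]_(a + b, n).
  rewrite -!scalemxAl const1_incidence.
  have -> : const_mx 2 = 2 *: const_mx 1 :> 'M[R]_(a + b, #|edge G|).
    by rewrite scalemx_const mulr1.
  rewrite -scalemxAl (const1_incidence_tr R V G t hreg).
  by apply/matrixP => i j; rewrite !mxE; ring.
have dH :
  \det (k%:M - l *: Aalpha G alpha) = h * \prod_(u <- behead s) (k - l * u).
  rewrite (det_scalar_sub _ _ _ _ (char_poly_Aalpha R alpha V G)) -/s.
  by rewrite sE big_cons.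
rewrite HE DE; set H := k%:M - _ in dH *.
move: qs0; under eq_bigr do rewrite quadE.
rewrite sE big_cons -/h -dH => dH0.
have uH : H \in unitmx by rewrite unitmxE unitfE.
have h0 : h != 0 by apply: contraNneq dH0 => h0; rewrite dH h0 mul0r.
have H1 : H *m const_mx 1 = const_mx h :> 'cV_ _.
  rewrite mulmxBl mul_scalar_mx -scalemxAl (Aalpha_const1 R alpha V G t hreg).
  by apply/matrixP => i j; rewrite !mxE /h mulr1.
have := det_three_parts _ _ a b _ _ _ _ c (q - c * (2 * t%:R)) uH h0 y0 z0 H1.
set y := x - _ * (_ + b%:R); set z := x - _ * (_ + a%:R).
set d := \det _ => dE.
(* The cancelled [h] is the quadratic of the eigenvalue [t]; [y] and [z] lower the exponents [a] and
   [b] by one. *)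
apply: (mulfI (_ : h * y * z != 0)); first by rewrite !mulf_neq0.
rewrite mulrCA dE dH; under [in RHS]eq_bigr do rewrite quadE.
set P := \prod_(_ <- _) _; rewrite /m -/n.
have -> : (join_quartic R alpha t n (a + b) a b).[x] =
  h * (y * z - c ^+ 2 * a%:R * b%:R) - c ^+ 2 * (q - c * (2 * t%:R)) * n%:R *
      (a%:R * z + b%:R * y + 2 * c * a%:R * b%:R).
  rewrite /join_quartic !(hornerD, hornerN, hornerM, hornerXn, hornerZ, hornerX,
    hornerC).
  by rewrite /h /k /l /p /q /y /z /c /n2 natrD; ring.
have -> : y ^+ a = y * y ^+ (a - 1) by rewrite -exprS subn1 prednK.
have -> : z ^+ b = z * z ^+ (b - 1) by rewrite -exprS subn1 prednK.
set Q := h * (y * z - _) - _; move: Q P (q ^+ _) (y ^+ _) (z ^+ _) => Q P u v w.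
ring.
Qed.

End JoinCharPoly.

(** * The trace of [Aalpha] and the assembly of the spectrum *)

Lemma sum_spectrum_Aalpha {R : rcfType} (alpha : R) {V : finType}
    (G : sgraph V) t : regular t G -> (0 < #|V|)%N ->
  \sum_(x <- sort >=%R (spectrum (Aalpha G alpha))) x = alpha * t%:R * #|V|%:R.
Proof.
move=> hreg V0; set s := sort _ _.
have sE := char_poly_Aalpha R alpha V G; rewrite -/s in sE.
have ss : size s = #|V|.
  by have := congr1 (fun p : {poly R} => size p) sE;
    rewrite size_char_poly size_prod_XsubC => -[].
have := char_poly_trace (Aalpha G alpha) V0.
rewrite sE -{1}ss coefPn_prod_XsubC ?ss -?lt0n // => /oppr_inj ->.
rewrite /mxtrace (eq_bigr (fun _ => alpha * t%:R)).
  by rewrite sumr_const card_ord -[LHS]mulr_natr.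
by move=> i _; rewrite (AalphaE R alpha V G t hreg) eqxx adj_irr mulr0 addr0.
Qed.

Lemma eq_horner {R : rcfType} (p q : {poly R}) :
  (forall x, p.[x] = q.[x]) -> p = q.
Proof.
by move=> pq; apply: (poly_eq_off_roots _ _ _ 1) => //; apply: oner_neq0.
Qed.

Theorem corollary3p2 (R : rcfType) (alpha : R) (V1 : finType) (G1 : sgraph V1)
    (t1 n1 m1 a b n2 : nat)
    (halpha : 0 <= alpha <= 1)
    (hreg : regular t1 G1) (hn1 : n1 = gorder G1) (hm1 : m1 = gsize G1)
    (hn1_gt0 : (0 < n1)%N) (ha : (0 < a)%N) (hb : (0 < b)%N)
    (hn2 : n2 = (a + b)%N) :
  let S := spectrum (Aalpha (qvjoin G1 (Kbip a b)) alpha) in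
  let lambda i := eigval (Aalpha G1 alpha) i in
  (t1 = 1%N -> connected G1 ->
    let quartic : {poly R} :=
      ('X^2 - (alpha * (3 + n2%:R)) *: 'X
        + (2 * alpha ^+ 2 * n2%:R + 4 * alpha - 2)%:P)
      * ('X^2 - (alpha * (4 + n2%:R)) *: 'X
        + (4 * alpha ^+ 2 + 2 * alpha ^+ 2 * n2%:R
           + 2 * alpha * a%:R * b%:R - a%:R * b%:R)%:P)
      - (2 * (1 - alpha) ^+ 2) *:
        (('X - (2 * alpha)%:P)
         * (n2%:R *: ('X - (2 * alpha)%:P)
            - (alpha * n2%:R ^+ 2)%:P + (2 * a%:R * b%:R)%:P)) in
    size (mroots quartic) = 4%N
    /\ perm_eq S
         ([:: alpha * (1 + n2%:R)]
          ++ nseq (b - 1) (alpha * (a%:R + 2))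
          ++ nseq (a - 1) (alpha * (b%:R + 2))
          ++ mroots quartic))
  /\
  ((2 <= t1)%N ->
    let quadratic i : {poly R} :=
      'X^2 - (t1%:R - 2 + lambda i + alpha * (2 + t1%:R + n2%:R)) *: 'X
      - (2 * alpha * (1 - alpha) * n2%:R)%:P
      - ((1 - alpha * (1 + t1%:R + n2%:R)) * (t1%:R + lambda i))%:P in
    let quartic : {poly R} :=
      ('X^2 - (alpha * t1%:R + alpha * n2%:R + 2 * alpha + 2 * t1%:R - 2) *: 'X
        + (2 * alpha ^+ 2 * n2%:R + 2 * alpha * t1%:R ^+ 2
           + 2 * alpha * t1%:R * n2%:R + 2 * alpha * t1%:R
           - 2 * alpha * n2%:R - 2 * t1%:R)%:P)
      * ('X^2 - (alpha * (2 * n1%:R + n2%:R)) *: 'X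
        + (alpha ^+ 2 * n1%:R ^+ 2 + alpha ^+ 2 * n1%:R * n2%:R
           + 2 * alpha * a%:R * b%:R - a%:R * b%:R)%:P)
      - (n1%:R * (1 - alpha) ^+ 2) *:
        (('X + (2 - 2 * alpha - 2 * t1%:R)%:P)
         * (n2%:R *: ('X - (alpha * n1%:R)%:P)
            - (alpha * n2%:R ^+ 2)%:P + (2 * a%:R * b%:R)%:P)) in
    (forall i, (2 <= i <= n1)%N -> size (mroots (quadratic i)) = 2%N)
    /\ size (mroots quartic) = 4%N
    /\ perm_eq S
         (nseq (m1 - n1) (2 * alpha * (1 + t1%:R) - 2)
          ++ nseq (b - 1) (alpha * (n1%:R + a%:R))
          ++ nseq (a - 1) (alpha * (n1%:R + b%:R))
          ++ flatten [seq mroots (quadratic i) | i <- index_iota 2 n1.+1]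
          ++ mroots quartic)).

Proof.
move=> S lambda; subst n2.
have n0 : (0 < #|V1|)%N by rewrite -/(gorder G1) -hn1.
have cE := char_poly_join R alpha V1 G1 t1 a b halpha hreg n0 ha hb.
have mE : #|edge G1| = m1 by rewrite card_sig hm1.
move: cE; set s := sort _ _; set P := char_poly _ => cE.
rewrite mE -/(gorder G1) -hn1 in cE.
have Psplit : splits R P by apply/splits_char_poly_sym/Aalpha_sym.
have sn : size s = n1.
  have := congr1 (fun p : {poly R} => size p) (char_poly_Aalpha R alpha V1 G1).
  by rewrite size_char_poly size_prod_XsubC -/s -/(gorder G1) -hn1 => -[].
have [qm qs] := join_quartic_monic R alpha t1 n1 (a + b) a b.
have dm u := join_quadratic_monic R alpha t1 (a + b) u.
have c_neq0 k (u : R) : ('X - u%:P) ^+ k != 0.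
  by rewrite expf_neq0 ?polyXsubC_eq0.
have hand := regular_handshake _ _ hreg; rewrite -hm1 -hn1 in hand.
split.
- move=> t_eq1 G1c quartic; rewrite t_eq1 in hreg cE qm qs dm hand.
  have n_eq2 : n1 = 2%N.
    by rewrite hn1; apply: connected_1regular_order => //; rewrite -hn1.
  have m_eq1 : m1 = 1%N by move: hand; rewrite n_eq2; lia.
  rewrite n_eq2 m_eq1 in cE qm qs sn.
  have qE : join_quartic R alpha 1 2 (a + b) a b = quartic.
    apply: eq_horner => x; rewrite /join_quartic /quartic.
    rewrite !(hornerD, hornerN, hornerM, hornerXn, hornerZ, hornerX,
    hornerC).
    ring.
  rewrite qE in cE qm qs.
  (* The larger eigenvalue is the degree 1, and the trace [2 * alpha] determines the other. *)
  have s2 : s = [:: 1; 2 * alpha - 1].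
    have sE := sort_spectrum_Aalpha R alpha V1 G1 1 halpha hreg n0.
    have := sum_spectrum_Aalpha alpha G1 1 hreg n0.
    clear cE; move: sn sE; rewrite -/s -/(gorder G1) -hn1 n_eq2.
    case: s => [|x [|y []]] //= _ [->]; rewrite big_cons big_seq1 => h.
    by congr [:: _; _]; lra.
  have PE : P = ('X - (alpha * (1 + (a + b)%:R))%:P)
     * ('X - (alpha * (b%:R + 2))%:P) ^+ (a - 1)
     * ('X - (alpha * (a%:R + 2))%:P) ^+ (b - 1) * quartic.
    (* On the right, one of the two cancelled factors comes from the single edge, the other from the
       quadratic of [2 * alpha - 1], which factors. *)
    apply: (mulfI (c_neq0 2 (2 * alpha * (1 + 1) - 2))).
    rewrite cE s2 /= big_seq1.
    have -> : join_quadratic R alpha 1 (a + b) (2 * alpha - 1)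
      = ('X - (2 * alpha * (1 + 1) - 2)%:P)
        * ('X - (alpha * (1 + (a + b)%:R))%:P).
      apply: eq_horner => x; rewrite /join_quadratic.
      rewrite !(hornerD, hornerN, hornerM, hornerXn, hornerZ, hornerX,
    hornerC).
      ring.
    by rewrite ![_ + 2]addrC expr1 expr2 !mulrA.
  have qsplit : splits R quartic.
    by apply: splits_dvdp Psplit _ => //; rewrite PE dvdp_mull.
  split; first by rewrite size_mroots // qs.
  apply: perm_mroots; rewrite -/P PE !big_cat /= big_seq1 !big_nseq.
  rewrite !iter_mulr_1.
  by rewrite prod_mroots //; ring.
move=> t_ge2 quadratic quartic.
(* From [2 * m1 = n1 * t1]; hence the subtraction [m1 - n1] is not truncated. *)
have n_le_m : (n1 <= m1)%N by nia.
have PE : P = ('X - (2 * alpha * (1 + t1%:R) - 2)%:P) ^+ (m1 - n1)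
    * (\prod_(i <- index_iota 2 n1.+1) quadratic i)
    * ('X - (alpha * (n1%:R + b%:R))%:P) ^+ (a - 1)
    * ('X - (alpha * (n1%:R + a%:R))%:P) ^+ (b - 1) * quartic.
  apply: (mulfI (c_neq0 n1 (2 * alpha * (1 + t1%:R) - 2))).
  rewrite cE !mulrA -exprD subnKC //; congr (_ * _ * _ * _ * _).
  (* Entry [i] of [behead s], counted from 0, is the eigenvalue of index [i + 2]. *)
  rewrite (big_nth 0) size_behead sn -{1}[2%N]add0n big_addn subSS subn1.
  by apply: eq_bigr => i _; rewrite nth_behead /quadratic /lambda /eigval addn2.
have quadsplit i : i \in index_iota 2 n1.+1 -> splits R (quadratic i).
  move=> hi; apply: splits_dvdp Psplit _; first by case: (dm (lambda i)).
  rewrite PE; do 3 apply: dvdp_mulr; apply: dvdp_mull.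
  by rewrite (big_rem _ hi) dvdp_mulIl.
have qsplit : splits R quartic.
  by apply: splits_dvdp Psplit _ => //; rewrite PE dvdp_mull.
split; last split.
- move=> i hi; rewrite size_mroots; first by case: (dm (lambda i)) => _ ->.
  by apply: quadsplit; rewrite mem_index_iota.
- by rewrite size_mroots // qs.
apply: perm_mroots; rewrite -/P PE !big_cat /= !big_nseq !iter_mulr_1.
rewrite prod_mroots // big_flatten big_map.
(* The roots multiply back to [quadratic i] only for indices in the range, where splitting was
   established. *)
rewrite [X in _ = _ * (_ * (_ * (X * _)))](eq_big_seq quadratic).
  rewrite -!mulrA; congr (_ * _); rewrite [X in _ * X = _]mulrCA.
  rewrite (mulrCA (\prod_(_ <- _) _)); congr (_ * _).
  by rewrite (mulrCA (\prod_(_ <- _) _)).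
by move=> i hi; rewrite prod_mroots //; apply: quadsplit.
Qed.
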